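(* Let $n\ge 0$ be an integer and let $\mathbb{P}_n(t)=\mathrm{span}\{1,t,t^2,\ldots,t^n\}$. The space $\mathbb{P}_n(t)$ is invariant with respect to a linear transformation of the parameter; that is, for all real numbers $a_0\neq 0$ and $a_1$, $$\mathbb{P}_n(t)=\mathrm{span}\{1,\;a_0t+a_1,\;(a_0t+a_1)^2,\ldots,(a_0t+a_1)^n\}.$$
   Context: Spans are linear spans over $\mathbb{R}$ of functions of $t\in\mathbb{R}$. A linear transformation of the parameter is a substitution $t\mapsto a_0t+a_1$ with real numbers $a_0\neq 0$ and $a_1$. Invariance means that the basis functions with transformed parameter span the same space. *)

(* Defs.v *)
From HB Require Import structures.
From mathcomp Require Import all_boot all_order all_algebra.
From mathcomp Require Import boolp classical_sets functions reals.

Set Implicit Arguments.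
Unset Strict Implicit.
Unset Printing Implicit Defensive.

Import GRing.Theory.
Local Open Scope ring_scope.
Local Open Scope classical_set_scope.

(* MathComp's [span] needs a finite-dimensional [vectType], which the space of
   all functions of [t] is not. *)
Definition lin_span (R : pzRingType) (V : lmodType R) (m : nat)
    (F : 'I_m -> V) : set V :=
  [set v | exists c : 'I_m -> R, v = \sum_(i < m) c i *: F i].

(* [R^o] is [R] as a module over itself, so that functions of [t] form an
   [R]-module. *)
Definition Pspace (R : realType) (n : nat) : set (R -> R^o) :=
  lin_span (fun (i : 'I_n.+1) (t : R) => t ^+ i : R^o).
Arguments Pspace : clear implicits.

(* Main.v *)
(** A combination of the powers [g ^+ i], [i <= n], is a polynomial of degree at
    most [n] evaluated at [g]. Composing with [a0 * 'X + a1] or with its inverse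
    [a0^-1 * 'X - a0^-1 * a1] preserves the degree bound, whence both
    inclusions. *)

Require Import Defs.
From HB Require Import structures.
From mathcomp Require Import all_boot all_order all_algebra.
From mathcomp Require Import boolp classical_sets functions reals.

Set Implicit Arguments.
Unset Strict Implicit.
Unset Printing Implicit Defensive.

Import GRing.Theory.
Local Open Scope ring_scope.
Local Open Scope classical_set_scope.

(** The coefficients of the combination are those of [p]. With [g] arbitrary, both spans of the
    theorem are instances. *)
Lemma lin_span_powers (T : Type) (R : nzRingType) (n : nat) (g : T -> R) :
  lin_span (fun (i : 'I_n.+1) (t : T) => g t ^+ i : R^o) =
  [set f | exists2 p : {poly R}, (size p <= n.+1)%N & f = fun t => p.[g t]].
Proof.
apply/seteqP; split=> f /=.
  case=> c ->; exists (\poly_(i < n.+1) c (inord i)); first exact: size_poly.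
  apply/funext => t; rewrite fct_sumE horner_poly.
  by apply: eq_bigr => i _; rewrite inord_val.
case=> p sp ->; exists (fun i => p`_i).
(* Zero coefficients pad [p] up to degree [n]. *)
by apply/funext => t; rewrite fct_sumE (horner_coef_wide _ sp).
Qed.

(** Composition at most multiplies degrees, and the inner one is at most 1. *)
Lemma size_comp_affine (R : nzRingType) (p : {poly R}) (b c : R) :
  (size (p \Po (b *: 'X + c%:P)) <= size p)%N.
Proof.
(* The general size bound for a composition is a successor, too weak when [size p] is 0. *)
have [-> | p0] := eqVneq p 0; first by rewrite comp_poly0 size_poly0.
have sq : ((size (b *: 'X + c%:P)%R).-1 <= 1)%N.
  by rewrite -mul_polyC size_MXaddC; case: ifP; rewrite //= size_polyC_leq1.
apply: leq_trans (size_comp_poly_leq _ _) _.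
rewrite -[leqRHS]prednK ?size_poly_gt0 // ltnS -[leqRHS]muln1.
by rewrite leq_mul2l sq orbT.
Qed.

Theorem proposition2p5 (R : realType) (n : nat) (a0 a1 : R) (ha0 : a0 != 0) :
  Pspace R n =
  lin_span (fun (i : 'I_n.+1) (t : R) => (a0 * t + a1) ^+ i : R^o).
Proof.
rewrite /Pspace (lin_span_powers n id) (lin_span_powers n (fun t => a0 * t + a1)).
apply/seteqP; split=> f /= [p sp ->].
  (* The inner polynomial sends [a0 * t + a1] back to [t]; [a0 != 0] enters in this cancellation. *)
  exists (p \Po (a0^-1 *: 'X + (- (a0^-1 * a1))%:P)).
    exact: leq_trans (size_comp_affine _ _ _) sp.
  apply/funext => t; rewrite horner_comp !hornerE.
  by rewrite mulrDr mulKf // addrK.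
exists (p \Po (a0 *: 'X + a1%:P)).
  exact: leq_trans (size_comp_affine _ _ _) sp.
by apply/funext => t; rewrite horner_comp !hornerE.
Qed.
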